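(* Let $\ell\geq 2$ be an integer, let $j=2(\ell^2-1)$ and $n=j^2-2$. Then for all integers $k$, $$ r_k(n)=f_k^+(j)\, f_k^-(j), \qquad f_k^{\pm}(j)=\frac{\ell\, r_k(j)\pm\delta_k}{\ell\pm 1}, \qquad \delta_k=(-1)^{\lfloor (k+1)/2\rfloor}, $$ and $f_k^{+}(j), f_k^{-}(j)\in\mathbb{Z}$ for all $k$.
   Context: For an integer $m$, the sequence $(r_k(m))_{k\in\mathbb{Z}}$ is defined by $r_0(m)=1$, $r_1(m)=m-1$ and $r_{k+2}(m)=m\,r_{k+1}(m)-r_k(m)$ for all $k\in\mathbb{Z}$. *)

(* Defs.v *)
From HB Require Import structures.
From mathcomp Require Import all_boot all_order all_algebra.
From mathcomp Require Import ring zify.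

Set Implicit Arguments.
Unset Strict Implicit.
Unset Printing Implicit Defensive.

Import Order.TTheory GRing.Theory Num.Theory.
Local Open Scope ring_scope.

(* A pair (r_k, r_(k+1)) is moved one step to the right or to the left along
   the recurrence r_(k+2) = m r_(k+1) - r_k. *)
Definition rec_next (m : int) (p : int * int) : int * int :=
  (p.2, m * p.2 - p.1).

Definition rec_prev (m : int) (p : int * int) : int * int :=
  (m * p.1 - p.2, p.1).

(* The pair (r_k, r_(k+1)) is obtained from (r_0, r_1) = (1, m - 1). *)
Definition r (m k : int) : int :=
  match k with
  | Posz i => (iter i (rec_next m) (1, m - 1)).1
  | Negz i => (iter i.+1 (rec_prev m) (1, m - 1)).1
  end.

Lemma r0 (m : int) : r m 0 = 1.
Proof. by []. Qed.

Lemma r1 (m : int) : r m 1 = m - 1.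
Proof. by []. Qed.

Lemma rSS (m k : int) : r m (k + 2) = m * r m (k + 1) - r m k.
Proof.
case: k => [i|[|[|i]]].
- by rewrite -!PoszD addn2 addn1.
- by rewrite /=; ring.
- by rewrite /=; ring.
have -> : Negz i.+2 + 2 = Negz i by lia.
have -> : Negz i.+2 + 1 = Negz i.+1 by lia.
by rewrite /=; ring.
Qed.

(* The three equations determine the two-sided sequence. *)
Lemma r_unique (m : int) (u : int -> int) :
  u 0 = 1 -> u 1 = m - 1 ->
  (forall k : int, u (k + 2) = m * u (k + 1) - u k) ->
  forall k : int, u k = r m k.
Proof.
move=> u0 u1 uSS.
suff H (i : nat) : [/\ u i%:Z = r m i%:Z, u (i%:Z + 1) = r m (i%:Z + 1),
    u (- i%:Z) = r m (- i%:Z) & u (- i%:Z + 1) = r m (- i%:Z + 1)].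
  by case=> i; [case: (H i) | rewrite NegzE; case: (H i.+1)].
elim: i => [|i [h1 h2 h3 h4]]; first by rewrite oppr0 add0r u0 u1.
have e : (i.+1%:Z : int) = i%:Z + 1 by rewrite -addn1 PoszD.
have e2 : (i.+1%:Z : int) + 1 = i%:Z + 2 by rewrite e; ring.
have e3 : - (i.+1%:Z : int) + 1 = - i%:Z by rewrite e; ring.
have e4 : - (i.+1%:Z : int) + 2 = - i%:Z + 1 by rewrite e; ring.
split.
- by rewrite e.
- by rewrite e2 uSS rSS h1 h2.
- have := uSS (- i.+1%:Z); have := rSS m (- i.+1%:Z).
  rewrite e3 e4 h3 h4 => -> /eqP.
  by rewrite (inj_eq (addrI _)) eqr_opp => /eqP.
- by rewrite e3.
Qed.

(* Division of integers by the positive divisor 2 rounds down, so the exponent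
   is the floor of (k + 1) / 2 also for negative k. *)
Definition delta (k : int) : rat := (-1) ^ ((k + 1) %/ 2)%Z.

Definition f_plus (l j k : int) : rat :=
  (l%:Q * (r j k)%:Q + delta k) / (l%:Q + 1).

Definition f_minus (l j k : int) : rat :=
  (l%:Q * (r j k)%:Q - delta k) / (l%:Q - 1).

(* Main.v *)
Require Import Defs.
From mathcomp Require Import all_boot all_order all_algebra.
From mathcomp Require Import ring zify.

Import Order.TTheory GRing.Theory Num.Theory.
Local Open Scope ring_scope.

(** The form [a^2 + b^2 - m a b] is constant on pairs of consecutive terms of a
    sequence with [u_(k+2) = m u_(k+1) - u_k]. On [r_k(j)] its value is [2 - j],
    so [(j + 2) r_k(j)^2 - 2] satisfies the recurrence with coefficient
    [n = j^2 - 2] and equals [j r_k(n)]. For [j = 2 (l^2 - 1)] this reads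
    [(l^2 - 1) r_k(n) = (l r_k(j))^2 - 1], whose right side factors because
    [delta_k^2 = 1]. Since [delta_k = r_k(0)] and [r_k(j) = r_k(0)] modulo [j],
    hence modulo [l + 1] and [l - 1], both factors are integers. *)

(** Induction on the pair [P k], [P (k + 1)], fitted to second-order recurrences, which can be run
    in both directions. *)
Lemma int_ind2 (P : int -> Prop) :
  P 0 -> P 1 ->
  (forall k, P k -> P (k + 1) -> P (k + 2)) ->
  (forall k, P (k + 1) -> P (k + 2) -> P k) ->
  forall k, P k.
Proof.
move=> P0 P1 up down.
suff H k : P k /\ P (k + 1) by move=> k; case: (H k).
elim/int_ind: k => [//|i [Pi Pi1]|i [Pi Pi1]].
- have -> : i.+1%:Z = i%:Z + 1 by lia.
  by split=> //; rewrite -addrA; apply: up.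
- have e1 : - i.+1%:Z + 1 = - i%:Z by lia.
  have e2 : - i.+1%:Z + 2 = - i%:Z + 1 by lia.
  by rewrite e1; split=> //; apply: down; rewrite ?e1 ?e2.
Qed.

(** With [b] fixed, [a] and [m * b - a] sum to [m * b], so the quadratic [x^2 - m b x + b^2] takes
    the same value at both: a Vieta jump. *)
Lemma r_invariant (m k : int) :
  r m k ^+ 2 + r m (k + 1) ^+ 2 - m * r m k * r m (k + 1) = 2 - m.
Proof.
have step i : r m (i + 1) ^+ 2 + r m (i + 2) ^+ 2 - m * r m (i + 1) * r m (i + 2)
    = r m i ^+ 2 + r m (i + 1) ^+ 2 - m * r m i * r m (i + 1).
  by rewrite rSS; ring.
elim/int_ind: k => [|i IH|i IH]; first by rewrite add0r r0 r1; ring.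
- have -> : i.+1%:Z = i%:Z + 1 by lia.
  by rewrite -(addrA _ 1 1) step IH.
- have e1 : - i.+1%:Z + 1 = - i%:Z by lia.
  have e2 : - i.+1%:Z + 2 = - i%:Z + 1 by lia.
  by rewrite -step e1 e2.
Qed.

Lemma r_doubling (j k : int) :
  j * r (j ^+ 2 - 2) k = (j + 2) * r j k ^+ 2 - 2.
Proof.
set n := j ^+ 2 - 2.
have inv i := r_invariant j i.
have quad i : (j + 2) * r j (i + 2) ^+ 2 - 2 =
    n * ((j + 2) * r j (i + 1) ^+ 2 - 2) - ((j + 2) * r j i ^+ 2 - 2).
  have -> : n = j ^+ 2 - 2 by [].
  rewrite rSS; apply/eqP; rewrite -subr_eq0; apply/eqP.
  (* The two sides of [quad] differ by [2 * (j + 2)] times the defect of the invariant, which is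
     zero. *)
  transitivity (2 * (j + 2) * (r j i ^+ 2 + r j (i + 1) ^+ 2
    - j * r j i * r j (i + 1) - (2 - j))); first by ring.
  by rewrite inv subrr mulr0.
elim/int_ind2: k => [||k IH0 IH1|k IH1 IH2].
- by rewrite !r0; ring.
- by rewrite !r1 /n; ring.
- by rewrite quad -IH0 -IH1 rSS; ring.
- move: IH2; rewrite quad -IH1 rSS => E.
  apply/eqP; rewrite -subr_eq0; apply/eqP.
  transitivity (n * (j * r n (k + 1)) - ((j + 2) * r j k ^+ 2 - 2)
    - j * (n * r n (k + 1) - r n k)); first by ring.
  by rewrite E subrr.
Qed.

Lemma deltaSS (k : int) : delta (k + 2) = - delta k.
Proof.
rewrite /delta; have -> : ((k + 2 + 1) %/ 2)%Z = ((k + 1) %/ 2)%Z + 1 by lia.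
by rewrite exprzDr // expr1z mulrN1.
Qed.

Lemma delta_sqr (k : int) : delta k ^+ 2 = 1.
Proof.
by rewrite expr2 /delta -exprzMl // mulrNN mulr1 exp1rz.
Qed.

(** At [m = 0] the recurrence is a sign change every two steps. This integer form of [delta] allows
    divisibility arguments. *)
Lemma delta_r0 (k : int) : delta k = (r 0 k)%:Q.
Proof.
have rSS0 i : r 0 (i + 2) = - r 0 i by rewrite rSS mul0r sub0r.
elim/int_ind2: k => [||k IH _|k _] //.
- by rewrite deltaSS rSS0 IH mulrNz.
- by rewrite deltaSS rSS0 mulrNz => /oppr_inj.
Qed.

(** Modulo [j] the recurrence and its initial values become those for the coefficient 0. *)
Lemma dvdz_r_sub_r0 (j k : int) : (j %| r j k - r 0 k)%Z.
Proof.
have step i : r j (i + 2) - r 0 (i + 2) = j * r j (i + 1) - (r j i - r 0 i).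
  by rewrite !rSS; ring.
elim/int_ind2: k => [||k IH _|k _].
- by rewrite !r0 subrr dvdz0.
- by rewrite !r1 sub0r opprK subrK.
- by rewrite step rpredB ?dvdz_mulr.
- have -> : r j k - r 0 k = j * r j (k + 1) - (r j (k + 2) - r 0 (k + 2)).
    by rewrite step; ring.
  by move=> ?; rewrite rpredB ?dvdz_mulr.
Qed.

Lemma rat_div_int (a b : int) : b != 0 -> (b %| a)%Z -> a%:Q / b%:Q \is a Num.int.
Proof.
by move=> b0 /dvdzP[q ->]; rewrite intrM mulfK ?intr_eq0 // intr_int.
Qed.

Theorem theorem43 (l j n : int) (hl : 2 <= l)
    (hj : j = 2 * (l ^+ 2 - 1)) (hn : n = j ^+ 2 - 2) :
  forall k : int,
    (r n k)%:Q = f_plus l j k * f_minus l j k /\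
    f_plus l j k \is a Num.int /\ f_minus l j k \is a Num.int.
Proof.
move=> k.
have lp0 : l + 1 != 0 by lia.
have lm0 : l - 1 != 0 by lia.
have jp : (l + 1 %| j)%Z by apply/dvdzP; exists (2 * (l - 1)); rewrite hj; ring.
have jm : (l - 1 %| j)%Z by apply/dvdzP; exists (2 * (l + 1)); rewrite hj; ring.
have eqp : l%:Q + 1 = (l + 1)%:Q by rewrite intrD.
have eqm : l%:Q - 1 = (l - 1)%:Q by rewrite intrB.
split; last split.
- have key : (l ^+ 2 - 1) * r n k = l ^+ 2 * r j k ^+ 2 - 1.
    (* Doubling turns [l ^+ 2 - 1] into [j], so that [r_doubling] applies; there
       [j + 2 = 2 * l ^+ 2]. *)
    apply: (@mulfI _ (2 : int)) => //.
    by rewrite mulrA -hj hn r_doubling hj; ring.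
  have keyQ : (l%:Q ^+ 2 - 1) * (r n k)%:Q = l%:Q ^+ 2 * (r j k)%:Q ^+ 2 - 1.
    by move/(congr1 (fun z : int => z%:Q)): key; rewrite !(intrM, intrB, rmorphXn).
  have pQ : l%:Q + 1 != 0 by rewrite eqp intr_eq0.
  have mQ : l%:Q - 1 != 0 by rewrite eqm intr_eq0.
  rewrite /f_plus /f_minus mulf_div [X in X / _]mulrC -subr_sqr delta_sqr exprMn -keyQ.
  by field; rewrite pQ mQ.
- rewrite /f_plus delta_r0 eqp -intrM -intrD; apply: rat_div_int => //.
  (* Here [l] is -1 modulo [l + 1], which leaves a difference divisible by [j]; for [f_minus], [l]
     is 1 modulo [l - 1]. *)
  have -> : l * r j k + r 0 k = r j k * (l + 1) - (r j k - r 0 k) by ring.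
  by rewrite rpredB ?dvdz_mull // (dvdz_trans jp) ?dvdz_r_sub_r0.
- rewrite /f_minus delta_r0 eqm -intrM -intrB; apply: rat_div_int => //.
  have -> : l * r j k - r 0 k = r j k * (l - 1) + (r j k - r 0 k) by ring.
  by rewrite rpredD ?dvdz_mull // (dvdz_trans jm) ?dvdz_r_sub_r0.
Qed.
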